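(* Let $K$ be a compact Hausdorff space having the extension property. Let $L$ be a compact Hausdorff scattered space of finite height and let $F$ be a closed subset of $L$. Then every isometric copy of $C(L|F)$ in $C(K)$ is complemented; that is, for every linear isometric embedding $S:C(L|F)\to C(K)$, the image $S[C(L|F)]$ is a complemented subspace of $C(K)$.
   Context: All spaces of functions are real. For a compact Hausdorff space $K$, $C(K)$ is the Banach space of real-valued continuous functions on $K$ with the supremum norm. For a closed subset $F\subseteq K$, $\rho_F:C(K)\to C(F)$ is the restriction map $f\mapsto f|_F$, and $C(K|F)=\ker\rho_F$ is the subspace of functions vanishing on $F$. An extension operator for a closed set $F$ in $K$ is a bounded linear map $E_F:C(F)\to C(K)$ with $\rho_F\circ E_F=\mathrm{Id}_{C(F)}$. $K$ has the extension property if every nonempty closed subset of $K$ admits an extension operator in $K$. A scattered space $L$ has finite height if its iterated Cantor--Bendixson derivatives satisfy $L^{(n)}=\emptyset$ for some finite $n$ (where $L'$ is the set of non-isolated points of $L$). *)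

(* Defs.v *)
From HB Require Import structures.
From mathcomp Require Import all_boot all_order all_algebra.
From mathcomp Require Import all_classical all_reals all_analysis.
Unset Printing Implicit Defensive.
Import Order.TTheory GRing.Theory Num.Theory numFieldNormedType.Exports.
Local Open Scope classical_set_scope.
Local Open Scope ring_scope.

Section Defs.
Variable R : realType.

Definition Cfun {T : topologicalType} : set (T -> R) :=
  [set f : T -> R | continuous f].

(* supremum norm (sup of the empty set is 0 in mathcomp, matching C(empty)={0}) *)
Definition supnorm {T : Type} (f : T -> R) : R :=
  sup [set `|f x| | x in [set: T]].

Definition lin_on {T U : Type} (D : set (T -> R)) (S : (T -> R) -> (U -> R)) :=
  forall (a : R) (f g : T -> R), D f -> D g ->
    S (fun x => a * f x + g x) = (fun y => a * S f y + S g y).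

Definition bounded_on {T U : Type} (D : set (T -> R)) (S : (T -> R) -> (U -> R)) :=
  exists M : R, forall f, D f -> supnorm (S f) <= M * supnorm f.

Definition isometric_on {T U : Type} (D : set (T -> R)) (S : (T -> R) -> (U -> R)) :=
  forall f, D f -> supnorm (S f) = supnorm f.

(* E : C(F) -> C(K) is an extension operator for the closed set F of K;
   C(F) is the space of continuous functions on the subspace type F
   (set_type F, with the initial = subspace topology). *)
Definition extension_operator {K : topologicalType} (F : set K)
    (E : (F -> R) -> (K -> R)) :=
  [/\ forall g, Cfun g -> Cfun (E g),
      lin_on (@Cfun F) E,
      bounded_on (@Cfun F) E &
      forall g, Cfun g -> forall x : F, E g (set_val x) = g x].

Definition extension_property (K : topologicalType) :=
  forall F : set K, closed F -> F !=set0 ->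
    exists E : (F -> R) -> (K -> R), extension_operator F E.

Definition C_vanish {L : topologicalType} (F : set L) : set (L -> R) :=
  [set f : L -> R | continuous f /\ forall x, F x -> f x = 0].

Definition complemented {K : topologicalType} (Y : set (K -> R)) :=
  exists P : (K -> R) -> (K -> R),
    [/\ lin_on (@Cfun K) P, bounded_on (@Cfun K) P,
        forall f, Cfun f -> Y (P f) &
        forall y, Y y -> P y = y].

End Defs.

Definition scattered (T : topologicalType) :=
  forall A : set T, A !=set0 -> exists x, isolated A x.

Definition CB_derivative (T : topologicalType) (A : set T) : set T :=
  A `&` limit_point A.

Definition finite_height (T : topologicalType) :=
  exists n : nat, iter n (@CB_derivative T) [set: T] = set0.

(* Main.v *)
(* By Holsztynski's argument, each x outside F is represented by some t in K:
   S f t = f x for all f, or S f t = - f x for all f.  A function g on K would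
   be in the image of S as soon as its values, up to these signs, depended only
   on the represented point.  The extension property is used to correct g so
   that this holds over the points of F, then of F together with the last
   Cantor-Bendixson derivative of L, and so on: when one more level is added its
   new points are isolated, so it suffices to choose one representing t for each
   of them.  Continuity is obtained by showing that preimages of closed sets are
   projections of closed subsets of K * L, which are closed by compactness. *)
Require Import Defs.
From HB Require Import structures.
From mathcomp Require Import all_boot all_order all_algebra.
From mathcomp Require Import all_classical all_reals all_analysis.
From mathcomp Require Import ring lra.
Import Order.TTheory GRing.Theory Num.Theory numFieldNormedType.Exports.
Local Open Scope classical_set_scope.
Local Open Scope ring_scope.

(** * Closed projections along a compact factor *)

Section Topology.
Context {T U : topologicalType}.

(** The tube lemma for the complement of [A]: compactness merges the neighbourhoods of [x] found
    over the various [t] into one. *)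
Lemma closed_proj_compact (A : set (T * U)) :
  compact [set: T] -> closed A -> closed [set x | exists t, A (t, x)].
Proof.
move=> /compact_near_coveringP cT clA.
rewrite -openC openE => x /= nAx.
have nA : \forall y \near x, [set: T] `<=` (fun t => ~ A (t, y)).
  apply: (cT U (nbhs x) (fun y t => ~ A (t, y))) => t _.
  have : open (~` A) by rewrite openC.
  rewrite openE => /(_ (t, x)) /= [|[B C] [Bt Cx] BC].
    by move=> Atx; apply: nAx; exists t.
  by exists (B, C) => // -[u v] /BC.
by apply: filterS nA => y nA [t]; apply: nA.
Qed.

End Topology.

(** * Supremum norm, extension operators, derived sets *)

Section Supnorm.
Context {R : realType} {T : topologicalType}.
Implicit Types f : T -> R.

Lemma le_supnorm f x : compact [set: T] -> continuous f -> `|f x| <= supnorm R f.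
Proof.
move=> cT cf; rewrite /supnorm; apply: ub_le_sup; last by exists x.
have cnf : continuous (fun y => `|f y|).
  by move=> y; apply: continuous_comp; [exact: cf|exact: norm_continuous].
have ne : [set: T] !=set0 by exists x.
have [c _ fc] := compact_EVT_max ne cT (continuous_subspaceT cnf).
by exists `|f c| => _ [y _ <-]; apply: fc; rewrite inE.
Qed.

Lemma supnorm_le f (B : R) : 0 <= B -> (forall x, `|f x| <= B) -> supnorm R f <= B.
Proof.
move=> B0 fB; rewrite /supnorm.
have [->|] := eqVneq [set `|f x| | x in [set: T]] set0; first by rewrite sup0.
move=> /set0P ne; apply: ge_sup => //.
by move=> _ [x _ <-].
Qed.

Lemma supnorm_ge0 f : 0 <= supnorm R f.
Proof.
rewrite /supnorm; set A := (X in sup X).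
have [hs|hs] := pselect (has_sup A); last by rewrite sup_out.
have [[_ [x _ _]] ub] := hs.
by apply: (le_trans (normr_ge0 (f x))); apply: ub_le_sup => //; exists x.
Qed.

End Supnorm.

(** Adds the case of empty [H], served by the zero operator, and makes the norm bound pointwise with
    a nonnegative constant. *)
Lemma extension_operator_total {R : realType} {K : topologicalType} (H : set K) :
  compact [set: K] -> extension_property R K -> closed H ->
  exists (E : (H -> R) -> (K -> R)) (M : R), 0 <= M /\
    [/\ forall u, continuous u -> continuous (E u),
        lin_on R (@Cfun R H) E,
        forall u t, continuous u -> `|E u t| <= M * supnorm R u &
        forall u (h : H), continuous u -> E u (set_val h) = u h].
Proof.
move=> cK extK clH; have [H0|/set0P H0] := eqVneq H set0.
  exists (fun _ _ => 0), 0; split => //; split.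
  - by move=> u _; exact: cst_continuous.
  - by move=> a u v _ _; apply/funext => t; rewrite mulr0 addr0.
  - by move=> u t _; rewrite normr0 mul0r.
  - move=> u h.
    by have : (set0 : set K) (set_val h) by rewrite -H0; exact: set_valP.
have [E [cE linE [M ME] extE]] := extK H clH H0.
exists E, `|M|; split => //; split => // [u t cu|u h cu]; last exact: extE.
apply: (le_trans (le_supnorm _ t cK (cE u cu))).
apply: (le_trans (ME u cu)); apply: ler_wpM2r; last exact: ler_norm.
exact: supnorm_ge0.
Qed.

(** A point [z] of the derivative near [y] either equals [y] or is itself the required point of [A]
    other than [y]. *)
Lemma closed_CB_derivative (T : topologicalType) (A : set T) :
  closed A -> closed (CB_derivative T A).
Proof.
move=> clA y cly; split.
  by apply: clA => B yB; have [z [[Az _] Bz]] := cly B yB; exists z.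
move=> B yB; have [z [[Az lz] Bz]] := cly _ (nbhs_interior yB).
have [yz|zy] := eqVneq y z; first by rewrite yz; exact: lz.
by exists z; split => //; [rewrite eq_sym|exact: nbhs_singleton].
Qed.

(** * Signed representation of points of [L] by points of [K] *)

Section IsometricCopy.
Context {R : realType} {K L : topologicalType} (F : set L).
Variable S : (L -> R) -> (K -> R).

Let CF := C_vanish R F.

(** For [x] in [F] this says that every [S f] vanishes at [t]: the sign is then immaterial, and all
    points of [F] have the same representing points. *)
Definition represents (b : bool) (t : K) (x : L) :=
  forall f, CF f -> S f t = (-1) ^+ b * f x.

Lemma C_vanish_comb (a : R) f g : CF f -> CF g -> CF (fun x => a * f x + g x).
Proof.
move=> [cf f0] [cg g0]; split; last first.
  by move=> x Fx; rewrite f0// g0// mulr0 addr0.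
move=> x; apply: cvgD; last exact: cg.
by apply: cvgM; [exact: cvg_cst|exact: cf].
Qed.

Lemma C_vanishM (f g : L -> R) : continuous f -> CF g -> CF (fun x => f x * g x).
Proof.
move=> cf [cg g0]; split; last by move=> x Fx; rewrite g0// mulr0.
by move=> x; apply: cvgM; [exact: cf|exact: cg].
Qed.

Lemma peak_function x y : hausdorff_space L -> compact [set: L] -> closed F ->
  ~ F x -> exists2 f, CF f & [/\ f x = 1, (y <> x -> f y = 0) & forall z, 0 <= f z <= 1].
Proof.
move=> hL cL clF nFx.
have cl1 (z : L) : closed [set z].
  exact: (accessible_closed_set1 (hausdorff_accessible hL)).
(* The point [y] is added only if it differs from [x], so that taking [y = x] yields a plain peak
   function. *)
pose A := F `|` (if pselect (y = x) then set0 else [set y]).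
have clA : closed A.
  by apply: closedU => //; case: pselect => ?; [exact: closed0|exact: cl1].
have A0 : A `&` [set x] = set0.
  rewrite -subset0 => z [Az zx]; rewrite zx in Az; case: Az => //.
  by case: pselect => //= + /esym.
have [f [cf fA fx rf]] := urysohn_ext_itv (compact_normal hL cL) clA (cl1 x) A0 (@ltr01 R).
exists f.
  by split=> // z Fz; apply: fA; exists z => //; left.
split.
- by apply: fx; exists x.
- by move=> yx; apply: fA; exists y => //; right; case: pselect.
- by move=> z; have := rf (f z); rewrite /= in_itv/=; apply; exists z.
Qed.

Section Representation.
Hypothesis hL : hausdorff_space L.
Hypothesis cL : compact [set: L].
Hypothesis clF : closed F.

(** If [x] is outside [F], a function peaking at [x] and vanishing at any other [x'] forces [x' = x]
    and then equal signs; if both points lie in [F], both sides are 0. Hence a function vanishing on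
    [F] induces a well-defined function on the representing points. *)
Lemma represents_inj b b' t x x' (f : L -> R) : (forall z, F z -> f z = 0) ->
  represents b t x -> represents b' t x' ->
  (-1) ^+ b * f x = (-1) ^+ b' * f x'.
Proof.
move=> f0.
wlog nFx : b b' x x' / ~ F x => [hwlog r r'|].
  have [Fx|/hwlog] := pselect (F x); last exact.
  have [Fx'|/hwlog h] := pselect (F x'); first by rewrite !f0// !mulr0.
  by rewrite (h _ _ _ r' r).
move=> r r'; have [h Fh [hx hx' h01]] := peak_function x x' hL cL clF nFx.
have := r h Fh; rewrite r'// hx mulr1.
have [->|ne] := pselect (x' = x); first by rewrite hx mulr1 => ->.
by rewrite hx'// mulr0 => /esym/eqP; rewrite signr_eq0.
Qed.

Hypothesis cK : compact [set: K].
Hypothesis SC : forall f, CF f -> continuous (S f).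

Lemma closed_represents b : closed [set p : K * L | represents b p.1 p.2].
Proof.
have -> : [set p : K * L | represents b p.1 p.2] =
    \bigcap_(f in CF) [set p : K * L | S f p.1 - (-1) ^+ b * f p.2 = 0].
  apply/seteqP; split => p /= rp f Ff /=; first by rewrite rp// subrr.
  by apply/eqP; rewrite -subr_eq0; apply/eqP; exact: rp.
apply: closed_bigI => f Ff.
have := @closed_eq R 0; apply: preimage_closed => p _.
apply: cvgB.
  by apply: continuous_comp; [exact: cvg_fst|exact: SC].
apply: cvgM; first exact: cvg_cst.
by apply: continuous_comp; [exact: cvg_snd|exact: Ff.1].
Qed.

Lemma closed_represented b (A : set K) : closed A ->
  closed [set x | exists2 t, A t & represents b t x].
Proof.
move=> clA.
have /(closed_proj_compact _ cK) : closed ([set p : K * L | represents b p.1 p.2]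
    `&` fst @^-1` A).
  apply: closedI; first exact: closed_represents.
  by apply: preimage_closed => // p _; exact: cvg_fst.
congr closed; apply/seteqP; split => x /=.
  by move=> [t [rt At]]; exists t.
by move=> [t At rt]; exists t.
Qed.

Lemma closed_representing b (A : set L) : closed A ->
  closed [set t | exists2 x, A x & represents b t x].
Proof.
move=> clA.
have /(closed_proj_compact _ cL) : closed ([set p : L * K | represents b p.2 p.1]
    `&` fst @^-1` A).
  apply: closedI; last by apply: preimage_closed => // p _; exact: cvg_fst.
  have := closed_represents b.
  by apply: (@preimage_closed _ _ unstable.swap) => p _; exact: swap_continuous.
congr closed; apply/seteqP; split => x /=.
  by move=> [t [rt At]]; exists t.
by move=> [t At rt]; exists t.
Qed.

(** * Holsztynski's peaking argument *)

Hypothesis linS : lin_on R CF S.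
Hypothesis isoS : isometric_on R CF S.

Lemma ler_norm_isometric f t (B : R) : CF f -> 0 <= B ->
  (forall x, `|f x| <= B) -> `|S f t| <= B.
Proof.
move=> Ff B0 fB; apply: le_trans (le_supnorm _ t cK (SC _ Ff)) _.
by rewrite isoS//; exact: supnorm_le.
Qed.

(** Negative values are allowed so that a peak function can be perturbed by a function of varying
    sign that vanishes at [x]. *)
Let peak x : set (L -> R) :=
  [set f | CF f /\ f x = 1 /\ forall z, `|f z| <= 1].

Lemma peak_attained x f : peak x f -> exists t, `|S f t| = 1.
Proof.
move=> [Ff [fx f1]].
have nf : supnorm R f = 1.
  apply/eqP; rewrite eq_le supnorm_le//= -[leLHS]normr1 -fx.
  by apply: le_supnorm => //; case: Ff.
(* On an empty [K] every norm is 0, whereas [S f] has norm 1. *)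
have [K0|/set0P ne] := eqVneq [set: K] set0.
  have : supnorm R (S f) <= 0.
    by apply: supnorm_le => // t; have : [set: K] t by []; rewrite K0.
  by rewrite isoS// nf ler10.
have cn : continuous (fun t => `|S f t|).
  by move=> t; apply: continuous_comp; [exact: SC|exact: norm_continuous].
have [t _ ft] := compact_EVT_max ne cK (continuous_subspaceT cn).
exists t; apply/eqP; rewrite eq_le ler_norm_isometric//= -nf -isoS//.
by apply: supnorm_le => // s; apply: ft; rewrite inE.
Qed.

Lemma norm1_sign (r : R) : `|r| = 1 -> exists b : bool, r = (-1) ^+ b.
Proof.
by case: (lerP 0 r) => [/ger0_norm|/ltr0_norm] -> r1; [exists false|exists true];
  rewrite ?expr0 ?expr1; lra.
Qed.

(** The function is [(f + g) / 2], nested in the shape [a * f + g] in which the linearity of [S] is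
    stated. *)
Lemma peak_average x f g : peak x f -> peak x g ->
  peak x (fun z => 2^-1 * (-1 * g z + f z) + g z).
Proof.
move=> [Ff [fx f1]] [Fg [gx g1]]; split.
  by do 2 apply: C_vanish_comb => //.
split; first by rewrite fx gx; lra.
by move=> z; move: (f1 z) (g1 z); rewrite !ler_norml => /andP[? ?] /andP[? ?]; lra.
Qed.

(** Both 1 and -1 are extreme points of the interval [-1, 1], so an average equal to one of them
    forces both values to agree with it. *)
Lemma average_norm1 x f g t : peak x f -> peak x g ->
  `|S f t| <= 1 -> `|S g t| <= 1 ->
  `|S (fun z => 2^-1 * (-1 * g z + f z) + g z) t| = 1 ->
  `|S f t| = 1 /\ S f t = S g t.
Proof.
move=> [Ff _] [Fg _]; rewrite linS//; last exact: C_vanish_comb.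
rewrite linS// !ler_norml => /andP[? ?] /andP[? ?] /norm1_sign [] [] /=;
  rewrite ?expr0 ?expr1 => e.
  have -> : S f t = -1 by lra.
  by rewrite normrN1; split => //; lra.
have -> : S f t = 1 by lra.
by rewrite normr1; split => //; lra.
Qed.

(* Holsztynski: the sets where |S f| = 1, for f peaking at x, are directed
   (average two peaking functions), so they share a point t; there every
   function vanishing at x is killed. *)
Lemma exists_represents x : ~ F x -> exists b t, represents b t x.
Proof.
move=> nFx.
have Sle1 f t : peak x f -> `|S f t| <= 1.
  by move=> [Ff [_ f1]]; exact: ler_norm_isometric.
have [h Fh [hx _ h01]] := peak_function x x hL cL clF nFx.
have ph : peak x h.
  split=> //; split=> // z; have /andP[? ?] := h01 z.
  by rewrite ger0_norm.
pose Z f := [set t | `|S f t| = 1].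
have FZ : ProperFilter (filter_from (peak x) Z).
  apply: filter_from_proper; last by move=> f /peak_attained.
  apply: filter_from_filter; first by exists h.
  move=> f g pf pg; exists (fun z => 2^-1 * (-1 * g z + f z) + g z).
    exact: peak_average.
  move=> t /(average_norm1 _ _ _ _ pf pg (Sle1 _ _ pf) (Sle1 _ _ pg)) [Sf1 SfSg].
  by split; rewrite /Z/= -?SfSg.
(* A cluster point of the filter lies in every [Z f], because these sets are closed. *)
have [t [_ clt]] := cK _ FZ filterT.
have Z1 f : peak x f -> `|S f t| = 1.
  move=> pf; have clZ : closed (Z f).
    have := @closed_eq R 1; apply: preimage_closed => s _.
    by apply: continuous_comp; [exact: (SC _ pf.1)|exact: norm_continuous].
  by apply: clZ => B tB; apply: clt => //; exists f.
have Zeq f g : peak x f -> peak x g -> S f t = S g t.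
  move=> pf pg; have pq := peak_average _ _ _ pf pg.
  by case: (average_norm1 _ _ _ _ pf pg (Sle1 _ _ pf) (Sle1 _ _ pg) (Z1 _ pq)).
(* Scale [g] by [c] so that [c * g] is bounded by 1, and let [p] be [h] damped by [1 - c * |g|].
   Both [p] and [c * g + p] peak at [x], so their images agree at [t]. *)
have S0 g : CF g -> g x = 0 -> S g t = 0.
  move=> Fg gx; pose c := (supnorm R g + 1)^-1.
  have B0 : 0 < supnorm R g + 1 by rewrite ltr_wpDl// supnorm_ge0.
  have c0 : 0 < c by rewrite invr_gt0.
  have cg z : 0 <= c * `|g z| <= 1.
    rewrite mulr_ge0 ?(ltW c0)//= mulrC ler_pdivrMr// mul1r.
    by apply: (le_trans (le_supnorm _ z cL Fg.1)); rewrite lerDl.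
  pose p z := (1 - c * `|g z|) * h z.
  have Fp : CF p.
    apply: C_vanishM => // z; apply: cvgB; first exact: cvg_cst.
    apply: cvgM; first exact: cvg_cst.
    by apply: continuous_comp; [exact: Fg.1|exact: norm_continuous].
  have p01 z : 0 <= p z <= 1 - c * `|g z|.
    have /andP[? ?] := cg z; have /andP[? ?] := h01 z.
    by rewrite /p; apply/andP; split; nra.
  have pp : peak x p.
    split=> //; split; first by rewrite /p gx hx normr0 mulr0 subr0 mulr1.
    move=> z; have /andP[? ?] := p01 z; have /andP[? ?] := cg z.
    by rewrite ger0_norm//; lra.
  have pq : peak x (fun z => c * g z + p z).
    split; first exact: C_vanish_comb.
    split; first by rewrite gx mulr0 add0r; case: pp => _ [].
    move=> z; have /andP[? ?] := p01 z.
    apply: (le_trans (ler_normD _ _)); rewrite normrM gtr0_norm//.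
    by rewrite [X in _ + X]ger0_norm//; lra.
  have := Zeq _ _ pq pp; rewrite linS// => /eqP.
  rewrite -subr_eq0 addrK mulf_eq0 gt_eqF//= => /eqP; exact.
have [b hb] := norm1_sign _ (Z1 _ ph).
exists b, t => f Ff.
(* Removing the multiple [f x * h] makes [f] vanish at [x]; the sign is the value of [S h] at
   [t]. *)
have := S0 (fun z => - f x * h z + f z); rewrite linS// hb hx.
move=> /(_ (C_vanish_comb _ _ _ Fh Ff)); rewrite mulr1 addNr => /(_ erefl) e.
by apply/eqP; rewrite -subr_eq0 mulrC -mulNr addrC; apply/eqP.
Qed.

(** * Left inverses of [S] built level by level *)

(* The first clause says that the restriction of T g to the closed set A is
   continuous. *)
Definition partial_inverse (A : set L) (T : (K -> R) -> (L -> R)) (M : R) :=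
  [/\ forall g, continuous g -> forall C : set R, closed C ->
        closed (A `&` T g @^-1` C),
      forall g x, F x -> T g x = 0,
      forall (a : R) g h x, continuous g -> continuous h -> A x ->
        T (fun t => a * g t + h t) x = a * T g x + T h x,
      forall g x, continuous g -> A x -> `|T g x| <= M * supnorm R g &
      forall f x, CF f -> A x -> T (S f) x = f x].

Lemma partial_inverse0 : partial_inverse F (fun _ _ => 0) 0.
Proof.
split=> //.
- move=> g cg C clC; have [C0|nC0] := pselect (C 0).
    by have -> : F `&` (fun=> 0) @^-1` C = F by apply/seteqP; split => [x []|x].
  have -> : F `&` (fun=> 0) @^-1` C = set0.
    by apply/seteqP; split => [x [_ /nC0]|x].
  exact: closed0.
- by move=> *; rewrite mulr0 addr0.
- by move=> *; rewrite normr0 mul0r.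
- by move=> f x [_ f0] /f0 ->.
Qed.

Hypothesis extK : extension_property R K.

(* Subtract from g an extension of the discrepancy, on the set H of points
   representing some x in B, between g and the function induced by T g; the
   corrected g is then consistent over B, and is read off at one chosen
   representing point for each x. *)
Lemma partial_inverse_step (A B : set L) T M : 0 <= M ->
  closed A -> closed B -> F `<=` B -> B `<=` A ->
  (forall x, A x -> ~ B x -> exists2 U, nbhs x U & U `&` A `<=` [set x]) ->
  partial_inverse B T M -> exists T' M', 0 <= M' /\ partial_inverse A T' M'.
Proof.
move=> M0 clA clB FB BA isoAB [Tcont TF Tlin Tbound TS].
pose H := [set t | exists b, exists2 x, B x & represents b t x].
have clH : closed H.
  have -> : H = [set t | exists2 x, B x & represents false t x] `|`
      [set t | exists2 x, B x & represents true t x].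
    apply/seteqP; split => t.
      by move=> [[] rt]; [right|left].
    by move=> [] rt; [exists false|exists true].
  by apply: closedU; exact: closed_representing.
have [E [ME [ME0 [Econt Elin Ebound Eext]]]] := extension_operator_total H cK extK clH.
(* The functional [ev x] is fixed before [g] is given, which keeps the new operator linear. *)
have /choice [ev evP] : forall x, exists ev : (K -> R) -> R,
    (F x -> forall g, ev g = 0) /\
    (~ F x -> exists b t, represents b t x /\ forall g, ev g = (-1) ^+ b * g t).
  move=> x; have [Fx|nFx] := pselect (F x); first by exists (fun=> 0).
  have [b [t rt]] := exists_represents x nFx.
  by exists (fun g => (-1) ^+ b * g t); split => // _; exists b, t.
have /choice [ps psP] : forall t, exists ps : (L -> R) -> R, H t ->
    exists b x, [/\ B x, represents b t x & forall f, ps f = (-1) ^+ b * f x].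
  move=> t; have [[b [x Bx rt]]|nHt] := pselect (H t); last by exists (fun=> 0).
  by exists (fun f => (-1) ^+ b * f x) => _; exists b, x.
pose u g (t : H) := g (set_val t) - ps (set_val t) (T g).
have psE g b t x : B x -> represents b t x -> ps t (T g) = (-1) ^+ b * T g x.
  move=> Bx rt; have Ht : H t by exists b, x.
  have [b' [x' [_ rt' ->]]] := psP t Ht.
  by apply: represents_inj rt' rt; exact: TF.
have ucont g : continuous g -> continuous (u g).
  move=> cg.
  have valc : continuous (@set_val K H) by exact: initial_continuous.
  suff psc : continuous (fun t : H => ps (set_val t) (T g)).
    move=> t; apply: cvgB; last exact: psc; first exact: nbhs_filter.
    by have := continuous_comp (valc t) (cg (set_val t)).
  apply/continuous_closedP => C clC.
  pose Cb (b : bool) := (fun r : R => (-1) ^+ b * r) @^-1` C.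
  have clCb b : closed (Cb b).
    apply: preimage_closed => // r _.
    by apply: cvgM; [exact: cvg_cst|exact: cvg_id].
  have -> : (fun t : H => ps (set_val t) (T g)) @^-1` C = set_val @^-1`
     ([set t | exists2 x, (B `&` T g @^-1` Cb false) x & represents false t x] `|`
      [set t | exists2 x, (B `&` T g @^-1` Cb true) x & represents true t x]).
    apply/seteqP; split => t /=.
      have [[] [x [Bx rt _]]] := psP _ (set_valP t);
        rewrite (psE g _ _ _ Bx rt) => Cx; [right|left]; by exists x.
    by move=> [] [x [Bx Cx] rt]; rewrite (psE g _ _ _ Bx rt).
  apply: preimage_closed; first by move=> t _; exact: valc.
  by apply: closedU; apply: closed_representing; exact: Tcont.
have ubound g t : continuous g -> `|u g t| <= (1 + M) * supnorm R g.
  move=> cg; rewrite /u; have [b [x [Bx rt ->]]] := psP _ (set_valP t).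
  apply: (le_trans (ler_normB _ _)); rewrite mulrDl mul1r lerD//.
    exact: le_supnorm.
  by rewrite normrMsign; exact: Tbound.
(* The extension [E] multiplies the bound [1 + M] for [u g] by [ME], and [g] itself adds 1. *)
have g3bound g t : continuous g ->
    `|g t - E (u g) t| <= (1 + ME * (1 + M)) * supnorm R g.
  move=> cg; apply: (le_trans (ler_normB _ _)); rewrite mulrDl mul1r lerD//.
    exact: le_supnorm.
  apply: (le_trans (Ebound _ _ (ucont _ cg))); rewrite -mulrA ler_wpM2l//.
  apply: supnorm_le => [|s]; last exact: ubound.
  by rewrite mulr_ge0 ?supnorm_ge0// addr_ge0.
have g3E g b t x : continuous g -> B x -> represents b t x ->
    g t - E (u g) t = (-1) ^+ b * T g x.
  move=> cg Bx rt; have Ht : H t by exists b, x.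
  pose t' : H := SigSub (mem_set Ht).
  have -> : E (u g) t = u g t' by rewrite -(Eext (u g) t')//; exact: ucont.
  by rewrite /u (psE g _ _ _ Bx rt) opprB addrC subrK.
pose T' g x := ev x (fun t => g t - E (u g) t).
have T'B g x : continuous g -> B x -> T' g x = T g x.
  move=> cg Bx; have [ev0 ev1] := evP x.
  have [Fx|nFx] := pselect (F x); first by rewrite /T' ev0// TF.
  by have [b [t [rt evE]]] := ev1 nFx; rewrite /T' evE (g3E _ _ _ _ cg Bx rt) signrMK.
have T'cont g (C : set R) : continuous g -> closed C -> closed (A `&` T' g @^-1` C).
  move=> cg clC; pose g3 t := g t - E (u g) t.
  pose P (b : bool) := [set x | exists2 t, C ((-1) ^+ b * g3 t) & represents b t x].
  have clP b : closed (P b).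
    apply: closed_represented.
    apply: (@preimage_closed _ _ (fun t => (-1) ^+ b * g3 t)) => // t _.
    apply: cvgM; first exact: cvg_cst.
    by apply: cvgB; [exact: cg|apply: Econt; exact: ucont].
  have clF0 : closed [set x | F x /\ C 0].
    have [C0|nC0] := pselect (C 0).
      by have -> : [set x | F x /\ C 0] = F by apply/seteqP; split => [x []|x].
    have -> : [set x | F x /\ C 0] = set0 by apply/seteqP; split => [x []|x].
    exact: closed0.
  (* Off [B], the closed set [D] may be too large, since it admits every representing point rather
     than the chosen one. Over [B] all choices give the value [T g x], so [D] is exact there; a
     closure point in [A] off [B] is isolated in [A] and hence already belongs to the set. *)
  pose D := P false `|` P true `|` [set x | F x /\ C 0].
  have clD : closed D by apply: closedU => //; exact: closedU.
  have subD : A `&` T' g @^-1` C `<=` D.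
    move=> x [Ax Cx]; have [ev0 ev1] := evP x.
    have [Fx|nFx] := pselect (F x).
      by right; split => //; move: Cx; rewrite /= /T' ev0.
    have [b [t [rt evE]]] := ev1 nFx; move: Cx; rewrite /= /T' evE => Cx.
    by left; case: b rt Cx {evE} => rt Cx; [right|left]; exists t.
  have DB x : B x -> D x -> C (T' g x).
    move=> Bx; rewrite T'B//; case; last by move=> [Fx]; rewrite TF.
    by case=> -[t + rt]; rewrite /g3 (g3E _ _ _ _ cg Bx rt) signrMK.
  move=> x clx.
  have Ax : A x.
    by apply: clA => V /clx [y [[Ay _] Vy]]; exists y.
  split=> //; have [Bx|nBx] := pselect (B x).
    by apply: DB => //; apply: clD => V /clx [y [/subD Dy Vy]]; exists y.
  have [V xV VA] := isoAB x Ax nBx.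
  by have [y [[Ay Cy] Vy]] := clx V xV; rewrite -(VA y (conj Vy Ay)).
exists T', (1 + ME * (1 + M)); split; first by rewrite addr_ge0// mulr_ge0// addr_ge0.
split.
- by move=> g cg C; exact: T'cont.
- by move=> g x Fx; rewrite /T' (evP x).1.
- move=> a g h x cg ch Ax; have [ev0 ev1] := evP x; rewrite /T'.
  have [Fx|nFx] := pselect (F x); first by rewrite !ev0// mulr0 addr0.
  have [b [t [rt evE]]] := ev1 nFx; rewrite !evE.
  have -> : u (fun t => a * g t + h t) = fun t => a * u g t + u h t.
    apply/funext => s; rewrite /u; have [b' [y [By rs psE']]] := psP _ (set_valP s).
    by rewrite !psE' Tlin//; ring.
  by rewrite Elin; [ring|exact: ucont|exact: ucont].
- move=> g x cg Ax; have [ev0 ev1] := evP x; rewrite /T'.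
  have [Fx|nFx] := pselect (F x).
    by rewrite ev0// normr0 mulr_ge0 ?supnorm_ge0// addr_ge0// mulr_ge0// addr_ge0.
  by have [b [t [_ ->]]] := ev1 nFx; rewrite normrMsign; exact: g3bound.
- move=> f x Ff Ax; have [ev0 ev1] := evP x; rewrite /T'.
  have [Fx|nFx] := pselect (F x); first by rewrite ev0// Ff.2.
  have [b [t [rt ->]]] := ev1 nFx.
  (* There is no discrepancy for [S f], since [T (S f)] agrees with [f] on [B]. *)
  have -> : E (u (S f)) t = 0.
    apply/eqP; rewrite -normr_le0.
    apply: (le_trans (Ebound _ _ (ucont _ (SC _ Ff)))).
    rewrite mulr_ge0_le0//; apply: supnorm_le => // s.
    have [b' [y [By rs psE']]] := psP _ (set_valP s).
    by rewrite /u psE' TS// rs// subrr normr0.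
  by rewrite subr0 rt// signrMK.
Qed.

(** Induction over all closed [A], so that the hypothesis applies to the derivative of [A]; the
    points then added are isolated in [A]. *)
Lemma partial_inverse_CB n (A : set L) : closed A ->
  iter n (@CB_derivative L) A = set0 ->
  exists T M, 0 <= M /\ partial_inverse (A `|` F) T M.
Proof.
elim: n A => [A _ /= ->|n IHn A clA].
  by exists (fun _ _ => 0), 0; split => //; rewrite set0U; exact: partial_inverse0.
rewrite iterSr => /(IHn _ (closed_CB_derivative _ _ clA)) [T [M [M0 TM]]].
apply: partial_inverse_step M0 _ _ _ _ _ TM.
- exact: closedU.
- by apply: closedU => //; exact: closed_CB_derivative.
- exact: subsetUr.
- by move=> x [[Ax _]|Fx]; [left|right].
- move=> x [Ax|Fx] nx; last by case: nx; right.
  have : ~ limit_point A x by move=> lx; apply: nx; left.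
  move=> /existsNP [U /not_implyP [xU noU]].
  (* Removing [F] isolates [x] in the union of [A] and [F], not merely in [A]. *)
  exists (U `&` ~` F).
    apply: filterI => //; apply: open_nbhs_nbhs; split; first by rewrite openC.
    by move=> Fx; apply: nx; right.
  move=> y [[Uy nFy] [Ay|//]] /=; apply: contrapT => /eqP yx.
  by apply: noU; exists y.
Qed.

End Representation.
End IsometricCopy.

Theorem theorem2p4 (R : realType) (K L : topologicalType) (F : set L) :
  hausdorff_space K -> compact [set: K] -> extension_property R K ->
  hausdorff_space L -> compact [set: L] -> scattered L -> finite_height L ->
  closed F ->
  forall S : (L -> R) -> (K -> R),
    (forall f, C_vanish R F f -> Cfun R (S f)) ->
    lin_on R (C_vanish R F) S ->
    isometric_on R (C_vanish R F) S ->
    complemented R (S @` C_vanish R F).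
Proof.
move=> _ cK extK hL cL _ [n htL] clF S SC linS isoS.
have [T [M [M0 []]]] :=
  partial_inverse_CB F S hL cL clF cK SC linS isoS extK n setT closedT htL.
rewrite setTU => Tcont TF Tlin Tbound TS.
have TCF g : Cfun R g -> C_vanish R F (T g).
  move=> cg; split; last exact: TF.
  by apply/continuous_closedP => C /(Tcont g cg); rewrite setTI.
(* As [T] is a left inverse of [S], the composite is a projection onto the image, and the isometry
   [S] preserves the bound [M]. *)
exists (S \o T); split.
- move=> a f g cf cg /=; rewrite -linS; [|exact: TCF..].
  by congr S; apply/funext => x; exact: Tlin.
- exists M => g cg /=; rewrite isoS; last exact: TCF.
  apply: supnorm_le => [|x]; last exact: Tbound.
  by rewrite mulr_ge0// supnorm_ge0.
- by move=> g cg; exists (T g) => //; exact: TCF.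
- move=> _ [f Ff <-] /=; congr S; apply/funext => x; exact: TS.
Qed.
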